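(* Let $(\Omega,\Sigma,\mu)$ be a $\sigma$-finite measure space and let $K\subset L^1(\mu)$ be nonempty, bounded, closed, convex and measure-compact. Let $T:K\to K$ be nonexpansive. Let $H:K\to K$ be of the form $H(f)=\psi\circ f$, where $\psi:\mathbb R\to\mathbb R$ is $1$-Lipschitz and idempotent ($\psi\circ\psi=\psi$). Let $\mathcal G\subset\Sigma$ be a finite sub-$\sigma$-algebra and let $Q:=\mathbb E[\cdot\mid\mathcal G]$, an idempotent $L^1$-contraction, assumed to map $K$ into $K$. Put $\Phi:=Q\circ H\circ T$. Let $\delta$ be a real number and let $R:K\to L^1(\mu)$ be a map with $\|R(f)\|_1\le\delta$ for all $f\in K$. Define $\widehat Q(f):=Q(f)+R(f)$ for $f\in K$, and $\widehat\Phi:=\widehat Q\circ H\circ T$ ($\widehat Q$ need not be idempotent). Then for every $\epsilon>\delta$ there exists $x\in K$ with $\|\widehat\Phi(x)-x\|_1<\epsilon$. In particular, if $f^\star$ is a fixed point of $\Phi$, then $\|\widehat\Phi(f^\star)-f^\star\|_1\le\delta$.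
   Context: ''Bounded'' and ''closed'' refer to the norm $\|\cdot\|_1$ of $L^1(\mu)$. A set $K\subset L^1(\mu)$ is measure-compact if it is compact with respect to the topology of local convergence in measure, i.e. the topology in which $f_n\to f$ means $f_n\to f$ in measure on every measurable subset of $\Omega$ of finite measure. A map $S:K\to K$ is nonexpansive if $\|S(f)-S(g)\|_1\le\|f-g\|_1$ for all $f,g\in K$. $\mathbb E[f\mid\mathcal G]$ denotes the conditional expectation of $f\in L^1(\mu)$ with respect to $\mathcal G$, i.e. the integrable $\mathcal G$-measurable function with $\int_B\mathbb E[f\mid\mathcal G]\,d\mu=\int_B f\,d\mu$ for all $B\in\mathcal G$. *)

(* Defs.v *)
From HB Require Import structures.
From mathcomp Require Import all_boot all_order all_algebra.
From mathcomp Require Import all_classical all_reals all_analysis.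
From mathcomp Require Import measurable_realfun.
Set Implicit Arguments.
Unset Strict Implicit.
Unset Printing Implicit Defensive.
Import Order.TTheory GRing.Theory Num.Theory.
Import numFieldNormedType.Exports.
Local Open Scope classical_set_scope.
Local Open Scope ring_scope.

(** The space L^1(mu).  The library's [LspaceType1 mu] is the quotient of the
    integrable functions by a.e. equality, without algebraic structure; [L1 mu]
    is that type made into a normed module over [R].  An element coerces to a
    representative [T -> R], so statements about its values are to be read
    up to a.e. equality. *)
Definition L1 (d : measure_display) (T : measurableType d) (R : realType)
  (mu : {measure set T -> \bar R}) : Type := LspaceType1 mu.

Definition L1fun d (T : measurableType d) (R : realType)
  (mu : {measure set T -> \bar R}) (f : L1 mu) : T -> R := (f : LspaceType1 mu).
Coercion L1fun : L1 >-> Funclass.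

Section L1_structure.
Local Open Scope quotient_scope.
Context (d : measure_display) (T : measurableType d) (R : realType).
Variable mu : {measure set T -> \bar R}.

HB.instance Definition _ := gen_eqMixin (L1 mu).
HB.instance Definition _ := gen_choiceMixin (L1 mu).

Lemma L1_measurable (f : L1 mu) : measurable_fun setT f.
Proof.
rewrite /L1fun /aqEqMfun_to_fun.
have := @measurable_funPT _ _ _ _ (repr (LebesgueSpace.sort f)).
exact.
Qed.

Lemma L1_Lfun (f : L1 mu) : (f : T -> R) \in Lfun mu 1%:E.
Proof.
rewrite inE; apply/andP; split; rewrite inE/=; first exact: L1_measurable.
exact: Lebesgue_finite.
Qed.

Lemma L1_integrable (f : L1 mu) : mu.-integrable setT (EFin \o f).
Proof. exact/Lfun1_integrable/L1_Lfun. Qed.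

Lemma L1_ext (f g : L1 mu) : (f : T -> R) = g %[ae mu] -> f = g.
Proof.
case: f => f [[fP]]; case: g => g [[gP]]; rewrite /L1fun/= => fg.
suff E : f = g by case: _ / E gP {fg} => gP; rewrite (Prop_irrelevance fP gP).
by rewrite -[f]reprK -[g]reprK; apply/eqmodP/asboolP.
Qed.

Lemma toL1_subproof (f : T -> R) : mu.-integrable setT (EFin \o f) ->
  exists g : L1 mu, (g : T -> R) = f %[ae mu].
Proof.
move=> /[dup] /Lfun1_integrable/andP[]; rewrite !inE/= => mf ff intf.
have mf' : @measurable_fun _ _ T (measurableTypeR R) setT f by exact: mf.
pose f0 : {mfun T >-> measurableTypeR R} := @mfun_Sub _ _ T (measurableTypeR R) f (mem_set mf').
pose q : {mfun_ mu, T >-> measurableTypeR R} := \pi f0.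
have qf : (q : T -> R) = f %[ae mu].
  by have /eqmodP/asboolP := reprK q.
pose lexx1 := @lexx _ _ (1%:E : \bar R).
have qm : measurable_fun setT (q : T -> R).
  by rewrite /aqEqMfun_to_fun; have := @measurable_funPT _ _ _ _ (repr q); exact.
have qfin : finite_norm mu 1%:E (q : T -> R).
  move: ff; rewrite /finite_norm !Lnorm1.
  congr (_ < _)%E; apply: ae_eq_integral => //.
  - exact/measurableT_comp/measurable_EFinP.
  - exact/measurableT_comp/measurable_EFinP.
  - by move: qf; apply: filterS => x /= + xT => /(_ xT) ->.
by exists (LebesgueSpace.Pack (LebesgueSpace.Class (isFinLebesgue.Build d T R mu 1%:E lexx1 q qfin))).
Qed.

Definition toL1 (f : T -> R) (intf : mu.-integrable setT (EFin \o f)) : L1 mu :=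
  sval (cid (toL1_subproof intf)).

Lemma toL1E f intf : (@toL1 f intf : T -> R) = f %[ae mu].
Proof. exact: svalP (cid (toL1_subproof intf)). Qed.


Let addI (f g : L1 mu) : mu.-integrable setT (EFin \o (f \+ g)).
Proof. by have := integrableD measurableT (L1_integrable f) (L1_integrable g). Qed.

Let scaleI (k : R) (f : L1 mu) : mu.-integrable setT (EFin \o (k \*: f)).
Proof. by have := integrableZl measurableT k (L1_integrable f). Qed.

Let zeroI : mu.-integrable setT (EFin \o (cst 0 : T -> R)).
Proof. exact: integrable0. Qed.

Let add f g := toL1 (addI f g).
Let scale k f := toL1 (scaleI k f).
Let zero : L1 mu := toL1 zeroI.
Let opp := scale (-1).

Let addA : associative add.
Proof.
move=> f g h; apply: L1_ext.
apply: filterS2 (filterI (toL1E (addI f (add g h))) (toL1E (addI g h)))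
  (filterI (toL1E (addI f g)) (toL1E (addI (add f g) h))).
by move=> x /= [E1 E2] [E3 E4] xT; rewrite E1// E4//= E2// E3//= addrA.
Qed.

Let addC : commutative add.
Proof.
move=> f g; apply: L1_ext.
apply: filterS2 (toL1E (addI f g)) (toL1E (addI g f)) => x /= E1 E2 xT.
by rewrite E1// E2//= addrC.
Qed.

Let add0 : left_id zero add.
Proof.
move=> f; apply: L1_ext.
apply: filterS2 (toL1E (addI zero f)) (toL1E zeroI) => x /= E1 E2 xT.
by rewrite E1//= E2//= add0r.
Qed.

Let addN : left_inverse zero opp add.
Proof.
move=> f; apply: L1_ext.
apply: filterS3 (toL1E (addI (opp f) f)) (toL1E zeroI) (toL1E (scaleI (-1) f)).
move=> x /= E1 E2 E3 xT; rewrite E1//= E2//= E3//=.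
by rewrite /GRing.scale/= mulN1r addNr.
Qed.

HB.instance Definition _ := GRing.isZmodule.Build (L1 mu) addA addC add0 addN.

Lemma L1D (f g : L1 mu) : L1fun (f + g) = f \+ g %[ae mu].
Proof. exact: toL1E. Qed.

Let scaleA a b v : scale a (scale b v) = scale (a * b) v.
Proof.
apply: L1_ext.
apply: filterS3 (toL1E (scaleI a (scale b v))) (toL1E (scaleI b v))
  (toL1E (scaleI (a * b) v)) => x /= E1 E2 E3 xT.
by rewrite E1//= E3//= E2//= scalerA.
Qed.

Let scale1 : left_id 1 scale.
Proof.
move=> f; apply: L1_ext; apply: filterS (toL1E (scaleI 1 f)) => x /= E xT.
by rewrite E//= scale1r.
Qed.

Let scaleDr : right_distributive scale +%R.
Proof.
move=> a f g; apply: L1_ext.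
apply: filterS2 (filterI (toL1E (scaleI a (f + g))) (L1D f g))
  (filterI (L1D (scale a f) (scale a g)) (filterI (toL1E (scaleI a f)) (toL1E (scaleI a g)))).
move=> x /= [E1 E2] [E3 [E4 E5]] xT.
by rewrite E1//= E2//= E3//= E4//= E5//= scalerDr.
Qed.

Let scaleDl v : {morph scale^~ v: a b / a + b}.
Proof.
move=> a b; apply: L1_ext.
apply: filterS2 (filterI (toL1E (scaleI (a + b) v)) (toL1E (scaleI a v)))
  (filterI (L1D (scale a v) (scale b v)) (toL1E (scaleI b v))).
move=> x /= [E1 E2] [E3 E4] xT.
by rewrite E1//= E3//= E2//= E4//= scalerDl.
Qed.

HB.instance Definition _ := GRing.Zmodule_isLmodule.Build R (L1 mu)
  scaleA scale1 scaleDr scaleDl.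

Lemma L1Z (k : R) (f : L1 mu) : L1fun (k *: f) = k \*: (f : T -> R) %[ae mu].
Proof. exact: toL1E. Qed.

Definition L1norm (f : L1 mu) : R := fine 'N[mu]_1[EFin \o f].

Lemma L1normE (f : L1 mu) : (L1norm f)%:E = (\int[mu]_x `|(f x)%:E|)%E.
Proof.
rewrite /L1norm Lnorm1 fineK//.
by have /integrableP[_] := L1_integrable f; rewrite ge0_fin_numE// integral_ge0.
Qed.

Let norm_ae (f : L1 mu) (g : T -> R) : measurable_fun setT g ->
  (f : T -> R) = g %[ae mu] -> (L1norm f)%:E = (\int[mu]_x `|(g x)%:E|)%E.
Proof.
move=> mg fg; rewrite L1normE; apply: ae_eq_integral => //.
- exact/measurableT_comp/measurable_EFinP/L1_measurable.
- exact/measurableT_comp/measurable_EFinP.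
- by move: fg; apply: filterS => x /= + xT => /(_ xT) ->.
Qed.

Let normD f g : L1norm (f + g) <= L1norm f + L1norm g.
Proof.
rewrite -lee_fin EFinD (norm_ae _ (L1D f g)) ?L1normE; last first.
  by apply: measurable_funD; exact: L1_measurable.
rewrite -!Lnorm1; apply: eminkowski => //; exact: L1_measurable.
Qed.

Let normZ k f : L1norm (k *: f) = `|k| * L1norm f.
Proof.
apply: EFin_inj; rewrite EFinM (norm_ae _ (L1Z k f)) ?L1normE; last first.
  by apply: measurable_funM => //; exact: L1_measurable.
rewrite -ge0_integralZl//; last first.
  exact/measurableT_comp/measurable_EFinP/L1_measurable.
by apply: eq_integral => x _; rewrite /= normrM.
Qed.

Let norm0_eq0 f : L1norm f = 0 -> f = 0.
Proof.
move=> f0; apply: L1_ext.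
have H : ('N[mu]_1[EFin \o f] = 0)%E by rewrite Lnorm1 -L1normE f0.
have mf : measurable_fun setT (EFin \o f) by exact/measurable_EFinP/L1_measurable.
apply: filterS2 (Lnorm_eq0_eq0 mf lte01 H) (toL1E zeroI) => x /= E1 E2 xT.
by rewrite E2//=; have [] := E1 xT.
Qed.

HB.instance Definition _ :=
  Lmodule_isNormed.Build R (L1 mu) normD normZ norm0_eq0.

Lemma L1_normE (f : L1 mu) : `|f| = fine 'N[mu]_1[EFin \o f].
Proof. by []. Qed.

End L1_structure.
(** [L1 mu] with the topology of local convergence in measure instead of the
    norm topology: a basic entourage, indexed by a measurable set [A] of finite
    measure and [e > 0], is
    [{(f, g) | mu (A `&` [set x | e < `|f x - g x|]) < e}].  [cvg_in_measureP]
    below checks that sequences converge as expected. *)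
Definition L1_in_measure (d : measure_display) (T : measurableType d)
  (R : realType) (mu : {measure set T -> \bar R}) : Type := L1 mu.

Section local_convergence_in_measure.
Context (d : measure_display) (T : measurableType d) (R : realType).
Variable mu : {measure set T -> \bar R}.
Implicit Types (A : set T) (e : R) (f g h : L1 mu).

HB.instance Definition _ := gen_eqMixin (L1_in_measure mu).
HB.instance Definition _ := gen_choiceMixin (L1_in_measure mu).

Definition exceed A e f g : set T := A `&` [set x | e < `|f x - g x|].

Definition in_measure_index : set (set T * R) :=
  [set i | [/\ measurable i.1, (mu i.1 < +oo)%E & 0 < i.2]].

Definition in_measure_ent (i : set T * R) :
    set (L1_in_measure mu * L1_in_measure mu) :=
  [set fg | (mu (exceed i.1 i.2 fg.1 fg.2) < i.2%:E)%E].

Lemma measurable_exceed A e f g : measurable A -> measurable (exceed A e f g).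
Proof.
move=> mA; have mfg : measurable_fun A (fun x => `|f x - g x|).
  apply/measurableT_comp => //; apply: measurable_funB;
  by apply: (measurable_funS measurableT) => //; exact: L1_measurable.
have := mfg mA _ (measurable_itv `]e, +oo[).
congr measurable; apply/seteqP; split => x [Ax] /=;
  by rewrite /exceed/= in_itv/= andbT.
Qed.

Let exceedS A A' e e' f g : A `<=` A' -> e' <= e ->
  exceed A e f g `<=` exceed A' e' f g.
Proof.
move=> AA' ee' x [Ax /= ex]; split; [exact: AA'|exact: le_lt_trans ex].
Qed.

Let le_exceed A A' e e' f g : measurable A -> measurable A' -> A `<=` A' -> e' <= e ->
  (mu (exceed A e f g) <= mu (exceed A' e' f g))%E.
Proof.
move=> mA mA' AA' ee'; apply: le_measure; rewrite ?inE//; try exact: measurable_exceed.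
exact: exceedS.
Qed.

Let exceedC A e f g : exceed A e f g = exceed A e g f.
Proof. by apply/seteqP; split => x [Ax] /=; rewrite /exceed/= distrC. Qed.

Definition in_measure_entourage := filter_from in_measure_index in_measure_ent.

Let ent_filter : Filter in_measure_entourage.
Proof.
apply: filter_from_filter.
  by exists (set0, 1); split => //=; rewrite measure0 ltry.
move=> [A e] [A' e'] [/= mA Aoo e0] [/= mA' A'oo e'0].
exists (A `|` A', Num.min e e').
  split => /=; [exact: measurableU| |by rewrite lt_min e0].
  by rewrite (le_lt_trans (measureU2 _ _ _))// lte_add_pinfty.
move=> [f g] /=; rewrite /in_measure_ent/= => H; split => /=.
- apply: le_lt_trans (lt_le_trans H _); last by rewrite lee_fin ge_min lexx.
  apply: le_exceed => //; first exact: measurableU.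
  by rewrite ge_min lexx.
- apply: le_lt_trans (lt_le_trans H _); last first.
    by rewrite lee_fin ge_min lexx orbT.
  apply: le_exceed => //; first exact: measurableU.
  by rewrite ge_min lexx orbT.
Qed.

Let ent_diag (A : set (L1_in_measure mu * L1_in_measure mu)) : in_measure_entourage A -> diagonal `<=` A.
Proof.
move=> [[B e] [/= mB Boo e0] BA] [f g]; rewrite /diagonal/= => fg; apply: BA.
rewrite /in_measure_ent/= (_ : exceed _ _ _ _ = set0) ?measure0 ?lte_fin//.
apply/seteqP; split => // x [_] /=; rewrite fg subrr normr0 ltNge.
by rewrite ltW.
Qed.

Let ent_inv (A : set (L1_in_measure mu * L1_in_measure mu)) : in_measure_entourage A -> in_measure_entourage A^-1%relation.
Proof.
move=> [i iI iA]; exists i => // -[f g] /= H; apply: iA.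
by move: H; rewrite /in_measure_ent/= exceedC.
Qed.

Let ent_split (A : set (L1_in_measure mu * L1_in_measure mu)) : in_measure_entourage A ->
  exists2 B, in_measure_entourage B & (B \; B)%relation `<=` A.
Proof.
move=> [[B e] [/= mB Boo e0] BA]; exists (in_measure_ent (B, e / 2)).
  by exists (B, e / 2) => //; split => //=; rewrite divr_gt0.
move=> [f h] [g /= fg gh]; apply: BA; rewrite /in_measure_ent/= in fg gh *.
have := lteD fg gh; rewrite -EFinD -splitr; apply: le_lt_trans.
have mE := measurable_exceed (e / 2) _ _ mB.
apply: le_trans (measureU2 _ (mE f g) (mE g h)).
apply: le_measure; rewrite ?inE//; first exact: measurable_exceed.
  by apply: measurableU; exact: mE.
move=> x [Bx /= ex]; rewrite /exceed/=.
have [fgx|fgx] := ltP (e / 2) `|f x - g x|; [by left|right; split => //=].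
rewrite ltNge; apply/negP => ghx; move: ex; rewrite ltNge => /negP; apply.
rewrite -(subrKA (g x)) (le_trans (ler_normD _ _))//.
by rewrite [leRHS]splitr lerD.
Qed.

HB.instance Definition _ := isUniform.Build (L1_in_measure mu)
  ent_filter ent_diag ent_inv ent_split.

Lemma cvg_in_measureP (u : nat -> L1 mu) f :
  ((u : nat -> L1_in_measure mu) @ \oo --> (f : L1_in_measure mu)) <->
  forall A, measurable A -> (mu A < +oo)%E -> forall e, 0 < e ->
    mu (A `&` [set x | e < `|u n x - f x|]) @[n --> \oo] --> 0%E.
Proof.
split.
- move=> uf A mA Aoo e e0.
  apply/fine_cvgP; split.
    apply: nearW => n; rewrite ge0_fin_numE// (le_lt_trans _ Aoo)//.
    by apply: le_measure; rewrite ?inE//; exact: measurable_exceed.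
  apply/cvgrPdist_lt => e1 e10.
  pose m := Num.min e e1.
  have m0 : 0 < m by rewrite lt_min e0.
  near=> n.
  rewrite sub0r normrN ger0_norm ?fine_ge0//.
  have : in_measure_ent (A, m) (f, u n).
    near: n.
    apply: (uf [set g | in_measure_ent (A, m) (f, g)]).
    exists (in_measure_ent (A, m)).
      exists (A, m); first by split.
      exact: subset_refl.
    by move=> g; rewrite /xsection/= inE.
  rewrite /in_measure_ent/= exceedC => H.
  have : (mu (exceed A e (u n) f) < e1%:E)%E.
    apply: le_lt_trans (lt_le_trans H _).
      by apply: le_exceed => //; rewrite ge_min lexx.
    by rewrite lee_fin ge_min lexx orbT.
  move=> K; rewrite -lte_fin fineK// ge0_fin_numE//; exact: lt_trans K (ltry _).
- move=> H P [E [[A e] [/= mA Aoo e0] EP] PE].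
  have /fine_cvgP[fin /cvgrPdist_lt/(_ _ e0) cv] := H _ mA Aoo _ e0.
  suff : \forall n \near \oo, P (u n) by [].
  near=> n; apply: PE; rewrite /xsection/= inE; apply: EP.
  rewrite /in_measure_ent/= exceedC.
  have finn : mu (exceed A e (u n) f) \is a fin_num by near: n; exact: fin.
  rewrite -(fineK finn) lte_fin.
  have : `|0 - fine (mu (exceed A e (u n) f))| < e by near: n; exact: cv.
  by rewrite sub0r normrN ger0_norm ?fine_ge0.
Unshelve. all: by end_near. Qed.

End local_convergence_in_measure.

Definition measure_compact (d : measure_display) (T : measurableType d)
    (R : realType) (mu : {measure set T -> \bar R}) (K : set (L1 mu)) :=
  compact (K : set (L1_in_measure mu)).

Definition nonexpansive_on (R : realType) (V : normedModType R) (K : set V)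
    (S : V -> V) :=
  forall f g, K f -> K g -> `|S f - S g| <= `|f - g|.

Definition is_sub_sigma_algebra (d : measure_display) (T : measurableType d)
    (G : set (set T)) :=
  sigma_algebra setT G /\ G `<=` measurable.

(** [g] is a version of the conditional expectation of [f] given [G].  It is a
    relation because for infinite [mu] a conditional expectation given a finite
    [G] need not exist (an atom of [G] may have infinite measure); when it
    exists it is unique as an element of [L1 mu]. *)
Definition is_cond_exp (d : measure_display) (T : measurableType d)
    (R : realType) (mu : {measure set T -> \bar R}) (G : set (set T))
    (f g : L1 mu) :=
  (exists2 g0 : T -> R,
      @measurable_fun _ _ (g_sigma_algebraType G) R setT g0 &
      (g : T -> R) = g0 %[ae mu]) /\
  (forall B, G B ->
     \int[mu]_(x in B) (g x)%:E = \int[mu]_(x in B) (f x)%:E)%E.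

(* Main.v *)
(** A nonexpansive self-map [F] of a nonempty bounded convex set has approximate
    fixed points: the Picard iterates of the contraction
    [s F + (1 - s) x0], [0 <= s < 1], have successive distances of order [s^n],
    and this contraction is uniformly close to [F] when [s] is close to [1].
    The map [Q o H o T] is nonexpansive: [H] because [psi] is 1-Lipschitz, and
    [Q] because a version [u0] of the conditional expectation [u] of [h] has
    constant sign on [B = {0 < u0}] and on its complement, so that
    [|u| = int_B h - int_{~B} h <= |h|]. *)

Require Import Defs.
From mathcomp Require Import all_boot all_order all_algebra.
From mathcomp Require Import all_classical all_reals all_analysis.
From mathcomp Require Import measurable_realfun.
Set Implicit Arguments.
Unset Strict Implicit.
Import Order.TTheory GRing.Theory Num.Theory.
Import numFieldNormedType.Exports.
Local Open Scope classical_set_scope.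
Local Open Scope ring_scope.

(** * Approximate fixed points of nonexpansive maps in a normed space *)

Lemma convex_setP (R : realType) (V : normedModType R) (K : set V) (s : R)
    (x y : V) :
  convex_set K -> 0 <= s <= 1 -> K x -> K y -> K (s *: x + (1 - s) *: y).
Proof.
move=> cK /andP[s0 s1] Kx Ky.
(* [convex_set] takes its scalar bundled with this proof that it lies in [0, 1]. *)
have s01 : Itv.spec (@Itv.num_sem R) (Itv.Real `[0%Z, 1%Z]) s.
  by rewrite /= /Itv.num_sem/= in_itv/= s0 s1 num_real.
have := cK x y (Itv.mk s01) (mem_set Kx) (mem_set Ky).
by rewrite inE.
Qed.

Lemma nonexpansive_approx_fixpoint (R : realType) (V : normedModType R)
    (K : set V) (F : V -> V) :
  K !=set0 -> bounded_set K -> convex_set K -> set_fun K K F ->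
  nonexpansive_on K F ->
  forall e : R, 0 < e -> exists2 x, K x & `|F x - x| < e.
Proof.
move=> [x0 Kx0] /= /ex_strict_bound_gt0[M M0 KM] cK KF neF e e0.
have dK x y : K x -> K y -> `|x - y| <= M + M.
  move=> Kx Ky; rewrite (le_trans (ler_normB _ _))// lerD//.
    by have /ltW := KM x Kx.
  by have /ltW := KM y Ky.
pose C := M + M.
have C0 : 0 < C by rewrite addr_gt0.
(* [C] bounds the diameter of [K], so moving a fraction [t] of the way towards [x0] costs at most
   [t * C <= e / 2]. The minimum with 1 keeps [s = 1 - t] nonnegative. *)
pose t := Num.min 1 (e / 2 / C).
have t0 : 0 < t by rewrite lt_min ltr01 !divr_gt0.
have t1 : t <= 1 by rewrite ge_min lexx.
pose s := 1 - t.
have s0 : 0 <= s by rewrite subr_ge0.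
have s1 : s < 1 by rewrite ltrBlDr ltrDl.
have st : 1 - s = t by rewrite subKr.
pose S x := s *: F x + (1 - s) *: x0.
have KS x : K x -> K (S x).
  by move=> Kx; apply: convex_setP => //; [rewrite s0 ltW | exact: KF].
(* The anchor [x0] cancels, so [S] contracts distances by the factor [s < 1]. *)
have SB x y : S x - S y = s *: (F x - F y).
  by rewrite /S [- (_ *: F y + _)]opprD addrACA subrr addr0 -scalerBr.
pose x_ n := iter n S x0.
have Kx_ n : K (x_ n) by elim: n => // n IHn; exact: KS.
have dx_ n : `|x_ n.+1 - x_ n| <= C * s ^+ n.
  elim: n => [|n IHn]; first by rewrite expr0 mulr1; apply: dK => //; exact: KS.
  rewrite -[x_ n.+2]/(S (x_ n.+1)) -[X in _ - X]/(S (x_ n)) SB normrZ ger0_norm//.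
  rewrite exprS mulrCA ler_wpM2l//; exact: le_trans (neF _ _ (Kx_ _) (Kx_ _)) IHn.
have [n Cn] : exists n, C * s ^+ n < e / 2.
  have /cvgrPdist_lt cs : C * s ^+ n @[n --> \oo] --> (0 : R).
    by apply: cvg_geometric; rewrite ger0_norm.
  have [N _ /(_ N)/= HN] := cs _ (divr_gt0 e0 (ltr0Sn _ 1)).
  exists N; have := HN (leqnn _); rewrite sub0r normrN.
  exact: le_lt_trans (ler_norm _).
exists (x_ n) => //.
(* Pass through the next iterate: [F (x_ n)] is within [e / 2] of [x_ n.+1] by the choice of [t],
   and [x_ n.+1] is strictly within [e / 2] of [x_ n] by the choice of [n]. *)
rewrite -(subrKA (x_ n.+1)) (le_lt_trans (ler_normD _ _))// [ltRHS]splitr.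
rewrite ler_ltD//; last exact: le_lt_trans (dx_ n) Cn.
have -> : F (x_ n) - x_ n.+1 = t *: (F (x_ n) - x0).
  rewrite -[x_ n.+1]/(S (x_ n)) /S st scalerBr /s scalerBl scale1r.
  by rewrite opprD opprB !addrA [_ + _ *: _]addrC addrK.
rewrite normrZ gtr0_norm//.
rewrite (le_trans (ler_wpM2l (ltW t0) (dK _ _ (KF _ (Kx_ n)) Kx0)))//.
by rewrite -/C -ler_pdivlMr// /t ge_min lexx orbT.
Qed.

(** * Nonexpansiveness of composition with [psi] and of conditional expectation *)

Section L1_contractions.
Context (d : measure_display) (Omega : measurableType d) (R : realType).
Variable mu : {measure set Omega -> \bar R}.
Implicit Types (f g h u v : L1 mu) (A B : set Omega).

Lemma L1B f g : L1fun (f - g) = (f : Omega -> R) \- g %[ae mu].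
Proof.
rewrite -scaleN1r.
apply: filterS2 (L1D f (-1 *: g)) (L1Z (-1) g) => x /= E1 E2 xT.
by rewrite E1//= E2//= /GRing.scale/= mulN1r.
Qed.

Lemma L1_norm_Rintegral f : `|f| = \int[mu]_x `|f x|.
Proof. by rewrite /Rintegral -[RHS]/(fine (\int[mu]_x `|(f x)%:E|)%E) -L1normE. Qed.

Lemma L1_integrableS A f : measurable A -> mu.-integrable A (EFin \o f).
Proof. by move=> mA; apply: integrableS (L1_integrable f). Qed.

Lemma ae_eq_Rintegral A (f g : Omega -> R) : measurable A ->
  measurable_fun A f -> measurable_fun A g -> ae_eq mu A f g ->
  \int[mu]_(x in A) f x = \int[mu]_(x in A) g x.
Proof.
move=> mA mf mg fg; congr fine; apply: ae_eq_integral => //.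
- exact/measurable_EFinP.
- exact/measurable_EFinP.
- by apply: filterS fg => x /= + Ax => /(_ Ax) ->.
Qed.

Lemma ler_L1_norm u h : {ae mu, forall x, `|u x| <= `|h x|} -> `|u| <= `|h|.
Proof.
move=> uh; rewrite -lee_fin !L1normE.
apply: ae_ge0_le_integral => //.
- exact/measurableT_comp/measurable_EFinP/L1_measurable.
- exact/measurableT_comp/measurable_EFinP/L1_measurable.
- by apply: filterS uh => x /= uh _; rewrite lee_fin.
Qed.

Lemma lipschitz_comp_nonexpansive (psi : R -> R) (K : set (L1 mu))
    (H : L1 mu -> L1 mu) :
  1.-lipschitz psi ->
  (forall f, K f -> (H f : Omega -> R) = psi \o f %[ae mu]) ->
  nonexpansive_on K H.
Proof.
move=> psi1 HK f g Kf Kg; apply: ler_L1_norm.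
apply: filterS2 (filterI (L1B (H f) (H g)) (L1B f g))
  (filterI (HK f Kf) (HK g Kg)) => x /= [E1 E2] [E3 E4].
rewrite E1//= E2//= E3//= E4//=.
by have := psi1 (f x, g x) (conj I I); rewrite /= mul1r.
Qed.

(** Linearity reduces nonexpansiveness of conditional expectation to a norm bound for a single
    function. Subtraction in [L1 mu] is pointwise only almost everywhere, hence the passage through
    a.e. equal integrands. *)
Lemma is_cond_expB (G : set (set Omega)) f g u v :
  is_sub_sigma_algebra G ->
  is_cond_exp G f u -> is_cond_exp G g v -> is_cond_exp G (f - g) (u - v).
Proof.
move=> [_ Gm] [[u0 mu0 uu0] fu] [[v0 mv0 vv0] gv]; split.
  exists (u0 \- v0); first exact: measurable_funB.
  apply: filterS3 (L1B u v) uu0 vv0 => x /= E1 E2 E3 xT.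
  by rewrite E1//= E2//= E3.
move=> B GB; have mB : measurable B by exact: Gm.
have intB (w z : L1 mu) : (\int[mu]_(x in B) ((w - z : L1 mu) x)%:E =
    \int[mu]_(x in B) (w x)%:E - \int[mu]_(x in B) (z x)%:E)%E.
  rewrite -integralB_EFin//; try exact: L1_integrableS.
  apply: ae_eq_integral => //.
  - exact/measurable_EFinP/(measurable_funS measurableT)/L1_measurable.
  - apply/measurable_EFinP/measurable_funB;
      exact/(measurable_funS measurableT)/L1_measurable.
  - by apply: filterS (L1B w z) => x /= E _; rewrite E.
by rewrite !intB fu// gv.
Qed.

Lemma is_cond_exp_norm (G : set (set Omega)) h u :
  is_sub_sigma_algebra G -> is_cond_exp G h u -> `|u| <= `|h|.
Proof.
move=> [sG Gm] [[u0 mu0 uu0] hu].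
pose B := [set x | 0 < u0 x].
(* [B] is the preimage of an open half-line under [u0], hence lies in the sigma-algebra generated by
   [G], which is [G] itself. *)
have GB : G B.
  have := mu0 measurableT _ (measurable_itv `]0, +oo[).
  rewrite setTI -[X in X -> _]/(<<s G >> _) sigma_algebra_id//.
  by congr G; apply/seteqP; split => x /=; rewrite in_itv/= andbT.
have GCB : G (~` B) by rewrite -setTD; case: sG => _ /(_ _ GB).
have mB := Gm _ GB; have mCB := Gm _ GCB.
(* Here [c] is the constant sign of [u0] on [A]: it takes the absolute value out of the integral of
   [u], which then equals that of [h] because [A] is in [G]. *)
have part A (c : R) : G A -> `|c| <= 1 ->
    (forall x, A x -> `|u0 x| = c * u0 x) ->
    \int[mu]_(x in A) `|u x| <= \int[mu]_(x in A) `|h x|.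
  move=> GA c1 Ac; have mA := Gm _ GA.
  have mfA (w : L1 mu) : measurable_fun A w.
    exact/(measurable_funS measurableT)/L1_measurable.
  have -> : \int[mu]_(x in A) `|u x| = c * \int[mu]_(x in A) u x.
    rewrite -RintegralZl//; last exact: L1_integrableS.
    apply: ae_eq_Rintegral => //.
    - exact: measurableT_comp.
    - exact: measurable_funM.
    - by apply: filterS uu0 => x /= E Ax; rewrite E// Ac.
  have -> : \int[mu]_(x in A) u x = \int[mu]_(x in A) h x.
    by rewrite /Rintegral hu.
  apply: le_trans (ler_norm _) _; rewrite normrM.
  apply: le_trans (ler_piMl _ c1) _ => //.
  by apply: le_normr_Rintegral => //; exact: L1_integrableS.
have split_norm (w : L1 mu) :
    `|w| = \int[mu]_(x in B) `|w x| + \int[mu]_(x in ~` B) `|w x|.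
  rewrite -Rintegral_setU// ?setUv ?L1_norm_Rintegral//.
    exact/integrable_norm/L1_integrable.
  by apply/disj_setPS; rewrite setICr.
rewrite !split_norm lerD//.
- apply: (part _ 1) => //; first by rewrite normr1.
  by move=> x /= /ltW x0; rewrite mul1r ger0_norm.
- apply: (part _ (-1)) => //; first by rewrite normrN1.
  by move=> x /= /negP; rewrite -leNgt mulN1r => x0; rewrite ler0_norm.
Qed.

Lemma cond_exp_nonexpansive (G : set (set Omega)) (K : set (L1 mu))
    (Q : L1 mu -> L1 mu) :
  is_sub_sigma_algebra G -> (forall f, K f -> is_cond_exp G f (Q f)) ->
  nonexpansive_on K Q.
Proof.
move=> sG QK f g Kf Kg.
apply: (is_cond_exp_norm sG); apply: is_cond_expB => //; exact: QK.
Qed.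

End L1_contractions.

(** * Transfer from [Phi] to the perturbed map *)

Theorem proposition2 (d : measure_display) (Omega : measurableType d)
    (R : realType) (mu : {sigma_finite_measure set Omega -> \bar R})
    (K : set (L1 mu))
    (K_nonempty : K !=set0)
    (K_bounded : bounded_set K)
    (K_closed : closed K)
    (K_convex : convex_set K)
    (K_compact : measure_compact K)
    (T : L1 mu -> L1 mu)
    (T_K : set_fun K K T)
    (T_nonexpansive : nonexpansive_on K T)
    (psi : R -> R)
    (psi_lipschitz : 1.-lipschitz psi)
    (psi_idempotent : idempotent_fun psi)
    (H : L1 mu -> L1 mu)
    (H_K : set_fun K K H)
    (H_psi : forall f, K f -> (H f : Omega -> R) = psi \o f %[ae mu])
    (G : set (set Omega))
    (G_sub : is_sub_sigma_algebra G)
    (G_finite : finite_set G)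
    (Q : L1 mu -> L1 mu)
    (Q_K : set_fun K K Q)
    (Q_cond_exp : forall f, K f -> is_cond_exp G f (Q f))
    (delta : R)
    (E : L1 mu -> L1 mu)
    (E_delta : forall f, K f -> `|E f| <= delta) :
  let Phi := Q \o H \o T in
  let Qhat := fun f => Q f + E f in
  let Phihat := Qhat \o H \o T in
  (forall epsilon : R, delta < epsilon ->
     exists2 x, K x & `|Phihat x - x| < epsilon) /\
  (forall fstar, K fstar -> Phi fstar = fstar ->
     `|Phihat fstar - fstar| <= delta).
Proof.
move=> Phi Qhat Phihat.
have K_HT x : K x -> K (H (T x)) by move=> Kx; exact/H_K/T_K.
(* The perturbation enters once, evaluated at [H (T x)], a point of [K], where [E_delta] applies. At
   a fixed point of [Phi] it is the only term left. *)
have PhihatB x : Phihat x - x = E (H (T x)) + (Phi x - x).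
  by rewrite /Phihat /Qhat /Phi/= addrA [E _ + _]addrC.
split => [e de|f Kf Phif]; last first.
  by rewrite PhihatB Phif subrr addr0; exact/E_delta/K_HT.
have Phi_nonexpansive : nonexpansive_on K Phi.
  move=> f g Kf Kg.
  have /le_trans := cond_exp_nonexpansive G_sub Q_cond_exp (K_HT f Kf) (K_HT g Kg).
  apply; apply: le_trans (T_nonexpansive f g Kf Kg).
  exact: (lipschitz_comp_nonexpansive psi_lipschitz H_psi) (T_K _ Kf) (T_K _ Kg).
have Phi_K : set_fun K K Phi by move=> x Kx; exact/Q_K/K_HT.
(* The perturbation uses up [delta]; the slack [e - delta] is the accuracy asked of the approximate
   fixed point of [Phi]. *)
have ed : 0 < e - delta by rewrite subr_gt0.
have [x Kx Px] := nonexpansive_approx_fixpoint K_nonempty K_bounded K_convex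
  Phi_K Phi_nonexpansive ed.
exists x => //; rewrite PhihatB (le_lt_trans (ler_normD _ _))//.
by rewrite -(subrKC delta e) ler_ltD//; exact/E_delta/K_HT.
Qed.
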